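(* Let $\epsilon\ge0$. If an $\epsilon$-approximate pure $((n,K,\delta))_d$ QECC exists, then it is possible to $2\epsilon$-approximate $(\delta-1)$-uniformly mask all states of $\mathbb C^K$ to $(\mathbb C^d)^{\otimes n}$.
   Context: Notation: $[n]=\{1,\dots,n\}$; for $S\subseteq[n]$, $d_S=d^{|S|}$; for a pure state $|\psi\rangle$ (unit vector), $|\psi\rangle\langle\psi|_S=\mathrm{Tr}_{S^c}|\psi\rangle\langle\psi|$; $\|X\|=\sqrt{\mathrm{Tr}(X^\dagger X)}$ is the Hilbert–Schmidt norm. Approximate masking: an operation $\mathcal S$ is said to $\epsilon$-approximate $k$-uniformly mask the quantum information contained in states $\{|\varphi_i\rangle\}\subset\mathbb C^K$ to states $\{|\psi_i\rangle=\mathcal S(|\varphi_i\rangle)\}\subset(\mathbb C^d)^{\otimes n}$ if for all $|\psi_i\rangle,|\psi_j\rangle$ and all $S\subseteq[n]$ with $|S|=k$, $\bigl\|\,|\psi_i\rangle\langle\psi_i|_S-|\psi_j\rangle\langle\psi_j|_S\bigr\|\le\epsilon$. The operation is a linear isometry $\mathbb C^K\to(\mathbb C^d)^{\otimes n}$. Support and weight: let $\{e_j\}_{j\in\mathbb Z_{d^2}}$, $e_0=I_d$, be a basis of linear operators on $\mathbb C^d$ with $\mathrm{Tr}(e_i^\dagger e_j)=d\,\delta_{ij}$, and for $\alpha\in\mathbb Z_{d^2}^n$ let $E_\alpha=e_{\alpha_1}\otimes\cdots\otimes e_{\alpha_n}$, with $\mathrm{supp}(E_\alpha)=\{i: e_{\alpha_i}\ne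 I_d\}$. For $E=\sum_\alpha c_\alpha E_\alpha$ put $\mathrm{supp}(E)=\bigcup_{\alpha:c_\alpha\neq0}\mathrm{supp}(E_\alpha)$ and $\mathrm{wt}(E)=|\mathrm{supp}(E)|$. Approximate QECC: a $K$-dimensional subspace $\mathcal C$ of $(\mathbb C^d)^{\otimes n}$ with orthogonal projector $P$ is called an $\epsilon$-approximate $((n,K,\delta))_d$ QECC if for all states $|\psi\rangle\in\mathcal C$ and every linear operator $E$ with $\mathrm{wt}(E)<\delta$ and $\|E\|=\sqrt{d^n}$, with $S=\mathrm{supp}(E)$, $$\left|\langle\psi|E|\psi\rangle-\mathrm{Tr}\left(E\tfrac PK\right)\right|\le\epsilon\sqrt{d_S}.$$ Furthermore, the $\epsilon$-approximate $((n,K,\delta))_d$ QECC is called pure if (for all such $|\psi\rangle$, $E$, $S$) $$\left|\langle\psi|E|\psi\rangle-\tfrac1{d_S}\mathrm{Tr}(E_S)\right|\le\epsilon\sqrt{d_S},$$ where $E_S$ is the part of $E$ acting on $S$: $E=E_S\otimes I_{S^c}$. *)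

(* Defs.v *)
From HB Require Import structures.
From mathcomp Require Import all_boot all_order all_algebra.
From mathcomp Require Import sesquilinear spectral.

Set Implicit Arguments.
Unset Strict Implicit.
Unset Printing Implicit Defensive.

Import Order.TTheory GRing.Theory Num.Theory.

Local Open Scope ring_scope.
Local Open Scope sesquilinear_scope.

(* The tensor power of C^d over a finite set I of sites has the computational
   basis {ffun I -> 'I_d}; since matrix indices are ordinals, a basis label x
   is used as an index through enum_rank x and recovered by enum_val. *)
Definition label (d : nat) (I : finType) := {ffun I -> 'I_d}.

Definition ket (C : numClosedFieldType) (d : nat) (I : finType) :=
  'cV[C]_#|{: label d I}|.

Definition oper (C : numClosedFieldType) (d : nat) (I : finType) :=
  'M[C]_#|{: label d I}|.

Section Quantum.
Variable C : numClosedFieldType.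

(* For a column vector this is the usual norm of C^m. *)
Definition hsnorm m n (X : 'M[C]_(m, n)) : C := sqrtC (\tr (X ^t* *m X)).

Definition is_state m (psi : 'cV[C]_m) : Prop := hsnorm psi = 1.

Definition proj m (psi : 'cV[C]_m) : 'M[C]_m := psi *m psi ^t*.

Definition expect m (psi : 'cV[C]_m) (E : 'M[C]_m) : C :=
  (psi ^t* *m E *m psi) 0 0.

Section Sites.
Variables (d n : nat).

Definition sites (S : {set 'I_n}) : finType := {i : 'I_n | i \in S}.

Definition restr (S : {set 'I_n}) (x : label d 'I_n) : label d (sites S) :=
  [ffun i : sites S => x (val i)].

(* The partial trace over the complement of S: the pairs (x, y) below are
   exactly (a z, b z), with z ranging over the labels of ~: S. *)
Definition ptrace (S : {set 'I_n}) (A : oper C d 'I_n) : oper C d (sites S) :=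
  \matrix_(a, b)
    \sum_(x : label d 'I_n | restr S x == enum_val a)
      \sum_(y : label d 'I_n |
              (restr S y == enum_val b) && (restr (~: S) y == restr (~: S) x))
        A (enum_rank x) (enum_rank y).

(* B (x) I, with B acting on the sites in S and I on the remaining ones. *)
Definition tens_id (S : {set 'I_n}) (B : oper C d (sites S)) : oper C d 'I_n :=
  \matrix_(a, b)
    (B (enum_rank (restr S (enum_val a))) (enum_rank (restr S (enum_val b)))
     * (restr (~: S) (enum_val a) == restr (~: S) (enum_val b))%:R).

Definition dS (S : {set 'I_n}) : C := (d ^ #|S|)%:R.

Definition reduced (S : {set 'I_n}) (psi : ket C d 'I_n) : oper C d (sites S) :=
  ptrace S (proj psi).

Definition op_basis (e : 'I_(d ^ 2) -> 'M[C]_d) : Prop :=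
  [/\ basis_of fullv [seq e j | j : 'I_(d ^ 2)],
      forall j : 'I_(d ^ 2), j = 0%N :> nat -> e j = 1%:M
    & forall i j : 'I_(d ^ 2), \tr ((e i) ^t* *m e j) = d%:R * (i == j)%:R].

Section Support.
Variable e : 'I_(d ^ 2) -> 'M[C]_d.

Definition op_index := {ffun 'I_n -> 'I_(d ^ 2)}.

Definition tens_basis (alpha : op_index) : oper C d 'I_n :=
  \matrix_(a, b)
    \prod_(i < n) e (alpha i) ((enum_val a : label d 'I_n) i)
                              ((enum_val b : label d 'I_n) i).

(* The coefficient c_alpha in E = sum_alpha c_alpha E_alpha. *)
Definition op_coef (E : oper C d 'I_n) (alpha : op_index) : C :=
  coord [tuple tens_basis (enum_val k) | k < #|{: op_index}|]
        (enum_rank alpha) E.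

Definition supp_index (alpha : op_index) : {set 'I_n} :=
  [set i | e (alpha i) != 1%:M].

Definition supp (E : oper C d 'I_n) : {set 'I_n} :=
  \bigcup_(alpha : op_index | op_coef E alpha != 0) supp_index alpha.

Definition wt (E : oper C d 'I_n) : nat := #|supp E|.

Definition is_orthoproj (V : {vspace ket C d 'I_n}) (P : oper C d 'I_n) : Prop :=
  [/\ P ^t* = P, P *m P = P
    & forall v : ket C d 'I_n, v \in V <-> exists u, v = P *m u].

Definition approx_qecc (eps : C) (K delta : nat)
    (V : {vspace ket C d 'I_n}) : Prop :=
  \dim V = K /\
  exists2 P : oper C d 'I_n, is_orthoproj V P &
    forall (psi : ket C d 'I_n) (E : oper C d 'I_n),
      psi \in V -> is_state psi ->
      (wt E < delta)%N -> hsnorm E = sqrtC (d ^ n)%:R ->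
      `|expect psi E - \tr (E *m (K%:R^-1 *: P))| <= eps * sqrtC (dS (supp E)).

Definition pure_approx_qecc (eps : C) (K delta : nat)
    (V : {vspace ket C d 'I_n}) : Prop :=
  approx_qecc eps K delta V /\
  forall (psi : ket C d 'I_n) (E : oper C d 'I_n)
         (ES : oper C d (sites (supp E))),
    psi \in V -> is_state psi ->
    (wt E < delta)%N -> hsnorm E = sqrtC (d ^ n)%:R ->
    E = tens_id ES ->
    `|expect psi E - (dS (supp E))^-1 * \tr ES| <= eps * sqrtC (dS (supp E)).

End Support.

Definition isometry (K : nat) (f : {linear 'cV[C]_K -> ket C d 'I_n}) : Prop :=
  forall phi, hsnorm (f phi) = hsnorm phi.

(* A is the set of states whose information f masks. *)
Definition approx_masks (eps : C) (k K : nat) (A : 'cV[C]_K -> Prop)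
    (f : {linear 'cV[C]_K -> ket C d 'I_n}) : Prop :=
  isometry f /\
  forall phi1 phi2, A phi1 -> A phi2 ->
    forall S : {set 'I_n}, #|S| = k ->
      hsnorm (reduced S (f phi1) - reduced S (f phi2)) <= eps.

End Sites.
End Quantum.

(* Main.v *)
(* Let f be a linear isometry onto the code. For |S| = delta - 1 and two encoded
   states, let D be the difference of their reductions to S. The operator
   E = sqrt (d_S) / ||D|| D^* (x) I satisfies ||E|| = sqrt (d ^ n) and
   supp E \subset S, and its expectations in the two states differ by
   sqrt (d_S) ||D||. Both expectations lie within eps sqrt (d_S) of the common
   value Tr (E P / K), hence ||D|| <= 2 eps. That supp E \subset S holds because
   the E_alpha are orthogonal and e_j is traceless for j != 0. *)
Require Import Defs.
From HB Require Import structures.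
From mathcomp Require Import all_boot all_order all_algebra.
From mathcomp Require Import sesquilinear spectral.
From mathcomp Require Import complex reals.

Set Implicit Arguments.
Unset Strict Implicit.
Unset Printing Implicit Defensive.

Import Order.TTheory GRing.Theory Num.Theory.

Local Open Scope ring_scope.
Local Open Scope sesquilinear_scope.

Lemma sum_enum_rank (W : nmodType) (T : finType) (F : 'I_#|T| -> W) :
  \sum_k F k = \sum_x F (enum_rank x).
Proof. exact: (reindex _ (onW_bij _ (@enum_rank_bij T))). Qed.

(** * Hilbert-Schmidt inner product and orthonormal bases of subspaces *)

Section HilbertSchmidt.
Variable C : numClosedFieldType.
Implicit Types m n : nat.

Lemma hsdotE m n (X Y : 'M[C]_(m, n)) :
  \tr (X ^t* *m Y) = \sum_i \sum_j (X i j)^* * Y i j.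
Proof.
rewrite exchange_big; apply: eq_bigr => j _; rewrite mxE.
by apply: eq_bigr => i _; rewrite !mxE.
Qed.

Lemma hsdotC m n (X Y : 'M[C]_(m, n)) : \tr (X ^t* *m Y) = (\tr (Y ^t* *m X))^*.
Proof.
rewrite !hsdotE rmorph_sum; apply: eq_bigr => i _; rewrite rmorph_sum.
by apply: eq_bigr => j _; rewrite rmorphM /= conjCK mulrC.
Qed.

Lemma hsdot_ge0 m n (X : 'M[C]_(m, n)) : 0 <= \tr (X ^t* *m X).
Proof.
rewrite hsdotE; apply: sumr_ge0 => i _; apply: sumr_ge0 => j _.
by rewrite mulrC mul_conjC_ge0.
Qed.

Lemma hsnorm_ge0 m n (X : 'M[C]_(m, n)) : 0 <= hsnorm X.
Proof. by rewrite sqrtC_ge0 hsdot_ge0. Qed.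

Lemma hsnormZ m n (c : C) (X : 'M[C]_(m, n)) :
  0 <= c -> hsnorm (c *: X) = c * hsnorm X.
Proof.
move=> c0; rewrite /hsnorm [(c *: X)^T]linearZ /= map_mxZ.
rewrite -scalemxAl -scalemxAr !linearZ /= mulrA.
rewrite geC0_conj // -expr2 sqrtCM ?qualifE /= ?exprn_ge0 ?hsdot_ge0 //.
by rewrite sqrCK //.
Qed.

Lemma hsnorm_adj m n (X : 'M[C]_(m, n)) : hsnorm (X ^t*) = hsnorm X.
Proof. by rewrite /hsnorm trmxCK mxtrace_mulC. Qed.

Lemma expectE m (psi : 'cV[C]_m) (E : 'M[C]_m) :
  expect psi E = \tr (E *m proj psi).
Proof. by rewrite mulmxA mxtrace_mulC mulmxA [RHS]trace_mx11. Qed.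

(** [unitarymx] says that the rows of [B] are orthonormal, with [m < n] allowed; conjugating that
    relation shows that the columns of [B^T] are orthonormal. *)
Lemma hsnorm_mulmx_trunitary m n p (B : 'M[C]_(m, n)) (v : 'M[C]_(m, p)) :
  B \is unitarymx -> hsnorm (B^T *m v) = hsnorm v.
Proof.
move=> Bu; have BB : map_mx Num.conj B *m B^T = 1%:M.
  have := congr1 (map_mx Num.conj) (unitarymxP Bu).
  rewrite map_mxM map_scalar_mx rmorph1 => <-; congr (_ *m _).
  by apply/matrixP => i j; rewrite !mxE /= conjCK.
rewrite /hsnorm trmx_mul map_mxM trmxK mulmxA -[_ *m _ *m B^T]mulmxA BB.
by rewrite mulmx1.
Qed.

(** Gram-Schmidt applied to a basis of [V], written as rows because [schmidt] orthonormalises rows.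
    [B^T] will be the encoding isometry. *)
Lemma exists_orthonormal_basis n (V : {vspace 'cV[C]_n}) :
  exists2 B : 'M[C]_(\dim V, n), B \is unitarymx & forall v, B^T *m v \in V.
Proof.
pose M := \matrix_(i < \dim V) ((vbasis V)`_i)^T.
have MT (u : 'rV_(\dim V)) : (u *m M)^T = \sum_i u 0 i *: (vbasis V)`_i.
  rewrite mulmx_sum_row linear_sum; apply: eq_bigr => i _.
  by rewrite linearZ /= rowK trmxK.
have Mfree : row_free M.
  apply/inj_row_free => u /(congr1 trmx); rewrite MT trmx0 => u0.
  have /freeP/(_ _ u0) u0i := basis_free (vbasisP V).
  by apply/rowP => i; rewrite u0i mxE.
have leK : (\dim V <= n)%N by rewrite -(eqP Mfree) rank_leq_col.
exists (schmidt M) => [|v]; first exact: schmidt_unitarymx.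
(* Gram-Schmidt keeps the row space of [M], so [B^T *m v] is a combination of the basis vectors of
   [V]. *)
have /submxP[c cM] : (v^T *m schmidt M <= M)%MS.
  by rewrite (submx_trans (submxMl _ _)) // eqmx_schmidt_free.
rewrite -[v]trmxK -trmx_mul cM MT rpred_sum // => i _.
by rewrite rpredZ // vbasis_mem // mem_nth // size_tuple.
Qed.

End HilbertSchmidt.

(** * Splitting the sites into [S] and its complement *)

Section Sites.
Variables (C : numClosedFieldType) (d n : nat).
Implicit Types (S : {set 'I_n}) (A : oper C d 'I_n) (x y : label d 'I_n).

Lemma card_label (I : finType) : #|{: label d I}| = (d ^ #|I|)%N.
Proof. by rewrite card_ffun card_ord. Qed.

Lemma card_sites S : #|sites S| = #|S|.
Proof. by rewrite card_sig; apply: eq_card. Qed.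

Lemma restr_pair_bij S :
  bijective (fun x => (restr S x, restr (~: S) x)).
Proof.
apply: inj_card_bij => [x y [xyS xySc]|].
  apply/ffunP => i; have [iS|] := boolP (i \in S).
    by have /ffunP/(_ (exist _ i iS)) := xyS; rewrite !ffunE.
  rewrite -in_setC => iS.
  by have /ffunP/(_ (exist _ i iS)) := xySc; rewrite !ffunE.
by rewrite card_prod !card_label !card_sites -expnD cardsC.
Qed.

Lemma sum_restr (W : nmodType) S
    (F : label d (sites S) -> label d (sites (~: S)) -> W) :
  \sum_x F (restr S x) (restr (~: S) x) = \sum_a \sum_z F a z.
Proof.
by rewrite pair_bigA (reindex _ (onW_bij _ (restr_pair_bij S))).
Qed.

Lemma ptraceB S A A' : ptrace S (A - A') = ptrace S A - ptrace S A'.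
Proof.
apply/matrixP => a b; rewrite !mxE -sumrB; apply: eq_bigr => x _.
by rewrite -sumrB; apply: eq_bigr => y _; rewrite !mxE.
Qed.

Lemma tens_id_adj S (B : oper C d (sites S)) :
  (tens_id B) ^t* = tens_id (B ^t*).
Proof.
apply/matrixP => a b; rewrite !mxE rmorphM /= conjC_nat.
by rewrite [restr _ (enum_val a) == _]eq_sym.
Qed.

Lemma mxtrace_tens_idM S (B : oper C d (sites S)) A :
  \tr (tens_id B *m A) =
  \sum_x \sum_y B (enum_rank (restr S x)) (enum_rank (restr S y)) *
     (restr (~: S) x == restr (~: S) y)%:R * A (enum_rank y) (enum_rank x).
Proof.
rewrite /mxtrace sum_enum_rank; apply: eq_bigr => x _; rewrite mxE sum_enum_rank.
by apply: eq_bigr => y _; rewrite !mxE !enum_rankK.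
Qed.

(** The duality that characterises the partial trace: the identity factor forces the two labels to
    agree off [S], which is the condition in the inner sum of [ptrace]. *)
Lemma mxtrace_tens_id_ptrace S (B : oper C d (sites S)) A :
  \tr (tens_id B *m A) = \tr (B *m ptrace S A).
Proof.
rewrite mxtrace_tens_idM /mxtrace sum_enum_rank exchange_big.
under [RHS]eq_bigr do rewrite mxE sum_enum_rank.
rewrite [RHS]exchange_big (partition_big (restr S) xpredT) //.
apply: eq_bigr => b _.
under eq_bigr do rewrite (partition_big (restr S) xpredT) //=.
rewrite exchange_big; apply: eq_bigr => a _.
rewrite mxE mulr_sumr !enum_rankK; apply: eq_bigr => y /eqP <-.
rewrite mulr_sumr big_mkcondr /=; apply: eq_bigr => x /eqP <-.
by case: eqP => _; rewrite ?mulr1 // mulr0 mul0r.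
Qed.

(** Norms multiply over tensor factors, and the scalar is the norm of the identity on the complement
    of [S]. *)
Lemma hsnorm_tens_id S (B : oper C d (sites S)) :
  hsnorm (tens_id B) = sqrtC (d ^ #|~: S|)%:R * hsnorm B.
Proof.
rewrite /hsnorm -sqrtCM ?qualifE /= ?ler0n ?hsdot_ge0 //; congr sqrtC.
rewrite !hsdotE sum_enum_rank.
under eq_bigr do rewrite sum_enum_rank.
under eq_bigr => x _ do under eq_bigr => y _ do rewrite !mxE !enum_rankK.
(* The summand for row label [(a, z)] and column label [(b, z')]; only [z' = z] survives, so the sum
   for [B] is counted once per [z]. *)
pose F a z b z' : C :=
  (B (enum_rank a) (enum_rank b) * (z == z' :> label d (sites (~: S)))%:R)^*
  * (B (enum_rank a) (enum_rank b) * (z == z')%:R).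
rewrite (sum_restr (fun a z => \sum_y F a z (restr S y) (restr (~: S) y))).
rewrite sum_enum_rank mulr_sumr; apply: eq_bigr => a _.
under eq_bigr do rewrite (sum_restr (F _ _)) exchange_big.
have FE z z' : \sum_b F a z b z' =
   if z' == z then \sum_b (B (enum_rank a) (enum_rank b))^* *
      B (enum_rank a) (enum_rank b) else 0.
  rewrite /F eq_sym; case: eqP => _; last first.
    by rewrite big1 // => b _; rewrite mulr0 mulr0.
  by apply: eq_bigr => b _; rewrite mulr1.
under eq_bigr do under eq_bigr do rewrite FE.
under eq_bigr do rewrite -big_mkcond big_pred1_eq.
rewrite sumr_const sum_enum_rank mulr_natl; congr (_ *+ _).
by rewrite -card_sites -card_label.
Qed.

End Sites.

(* Translating the i-th letter of both labels changes only the i-th factor,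
   and averaging over the translations turns that factor into \tr (M i). *)
Lemma mxtrace_tens_id_prod (C : numClosedFieldType) d n (S : {set 'I_n})
    (B : oper C d (sites S)) (M : 'I_n -> 'M[C]_d) i :
  i \notin S -> \tr (M i) = 0 ->
  \tr (tens_id B *m \matrix_(a, b) \prod_j
     M j ((enum_val a : label d 'I_n) j) ((enum_val b : label d 'I_n) j)) = 0.
Proof.
(* For [d = 0] a label would have a letter at site [i] in the empty ['I_0]; for [d.+1] the letters
   form a cyclic group, which makes translation available. *)
case: d B M => [|d] B M iS trM; rewrite mxtrace_tens_idM.
  by rewrite big1 // => x; case: (x i).
pose shift c (x : label d.+1 'I_n) : label d.+1 'I_n :=
  [ffun j => if j == i then x j + c else x j].
have shift_inj c : injective (shift c).
  move=> x y /ffunP xy; apply/ffunP => j; have := xy j.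
  by rewrite !ffunE; case: eqP => // _ /addIr.
have shiftS c x : restr S (shift c x) = restr S x.
  by apply/ffunP => -[j jS]; rewrite !ffunE /=; case: eqP jS iS => // -> ->.
have shiftSc c x y : (restr (~: S) (shift c x) == restr (~: S) (shift c y)) =
                     (restr (~: S) x == restr (~: S) y).
  apply/eqP/eqP => /ffunP xy; apply/ffunP => j; have := xy j; rewrite !ffunE.
    by case: eqP => // _ /addIr.
  by move->.
under eq_bigr do under eq_bigr do rewrite mxE !enum_rankK.
set Z := LHS; suff /eqP : \sum_(c < d.+1) Z = 0.
  by rewrite sumr_const card_ord mulrn_eq0 => /eqP.
under eq_bigr => c _.
  rewrite /Z (reindex_inj (shift_inj c)).
  under eq_bigr do rewrite (reindex_inj (shift_inj c)).
  over.
rewrite exchange_big big1 // => x _; rewrite exchange_big big1 // => y _.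
under eq_bigr do rewrite !shiftS shiftSc.
(* The term survives only if [x] and [y] agree off [S], in particular at [i]; the factor at [i] is
   then a diagonal entry of [M i]. *)
rewrite -mulr_sumr; case: eqP => [xySc|_]; last by rewrite mulr0 mul0r.
have xyi : x i = y i.
  have iSc : i \in ~: S by rewrite inE.
  by have /ffunP/(_ (exist _ i iSc)) := xySc; rewrite !ffunE.
have prodE c : \prod_j M j (shift c y j) (shift c x j) =
    M i (x i + c) (x i + c) * \prod_(j | j != i) M j (y j) (x j).
  rewrite (bigD1 i) //= !ffunE eqxx -xyi; congr (_ * _).
  by apply: eq_bigr => j ji; rewrite !ffunE (negPf ji).
under eq_bigr do rewrite prodE.
rewrite -mulr_suml.
have <- : \tr (M i) = \sum_c M i (x i + c) (x i + c).
  exact: (reindex_inj (addrI (x i))).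
by rewrite trM mul0r mulr0.
Qed.

(** * Operator basis, coefficients and supports *)

Section Basis.
Variables (C : numClosedFieldType) (d n : nat).
Implicit Types (S : {set 'I_n}).
Variables (e : 'I_(d ^ 2) -> 'M[C]_d) (e_basis : op_basis e).
Hypothesis d_gt0 : (0 < d)%N.
Implicit Types alpha beta : op_index d n.

(** The trace of a tensor product is the product of the traces, and distinct indices differ at some
    site, whose factor vanishes. *)
Lemma hsdot_tens_basis alpha beta :
  \tr (tens_basis e alpha ^t* *m tens_basis e beta) =
  (d ^ n)%:R * (alpha == beta)%:R.
Proof.
have [_ _ e_orth] := e_basis.
transitivity (\prod_(i < n) \tr (e (alpha i) ^t* *m e (beta i))).
  under [RHS]eq_bigr do rewrite hsdotE.
  rewrite bigA_distr_bigA hsdotE sum_enum_rank; apply: eq_bigr => x _.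
  rewrite bigA_distr_bigA sum_enum_rank; apply: eq_bigr => y _.
  by rewrite !mxE rmorph_prod -big_split /= !enum_rankK.
under eq_bigr do rewrite e_orth.
rewrite big_split prodr_const card_ord natrX; congr (_ * _).
have [->|ab] := eqVneq; first by rewrite big1 // => i _; rewrite eqxx.
have /existsP[j abj] : [exists j, alpha j != beta j].
  by rewrite -negb_forall; apply: contra ab => /eqfunP/ffunP->.
by rewrite (bigD1 j) //= (negPf abj) mul0r.
Qed.

(** Orthogonality with nonzero norms gives freeness; the count [(d ^ 2) ^ n = (d ^ n) ^ 2] gives
    spanning. *)
Lemma tens_basis_basis :
  basis_of fullv [tuple tens_basis e (enum_val k) | k < #|{: op_index d n}|].
Proof.
rewrite basisEfree subvf; apply/andP; split; last first.
  rewrite size_tuple [#|_|]card_ffun !card_ord dimvf /dim /= !card_label card_ord.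
  by rewrite -expnMn mulnn expnAC.
apply/freeP => k; under eq_bigr do rewrite -tnth_nth tnth_mktuple.
move=> sum0 i.
have /eqP := congr1 (fun M => \tr (tens_basis e (enum_val i) ^t* *m M)) sum0.
rewrite mulmx0 mxtrace0 mulmx_sumr linear_sum (bigD1 i) //= big1 ?addr0.
  rewrite -scalemxAr linearZ /= hsdot_tens_basis eqxx mulr1 mulf_eq0 pnatr_eq0.
  by rewrite expn_eq0 eqn0Ngt d_gt0 orbF => /eqP.
move=> j ji; rewrite -scalemxAr linearZ /= hsdot_tens_basis.
by rewrite (inj_eq enum_val_inj) eq_sym (negPf ji) !mulr0.
Qed.

Lemma op_coefE E alpha :
  (d ^ n)%:R * op_coef e E alpha = \tr (tens_basis e alpha ^t* *m E).
Proof.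
rewrite {2}[E](coord_basis tens_basis_basis (memvf E)) sum_enum_rank.
under eq_bigr do rewrite -tnth_nth tnth_mktuple enum_rankK.
rewrite mulmx_sumr linear_sum (bigD1 alpha) //= -scalemxAr linearZ /=.
rewrite hsdot_tens_basis eqxx mulr1 mulrC big1 ?addr0 // => beta ba.
by rewrite -scalemxAr linearZ /= hsdot_tens_basis eq_sym (negPf ba) !mulr0.
Qed.

Lemma mxtrace_tens_id_basis S (B : oper C d (sites S)) alpha i :
  i \notin S -> e (alpha i) != 1%:M ->
  \tr (tens_id B *m tens_basis e alpha) = 0.
Proof.
have [_ e0 e_orth] := e_basis; move=> iS ei.
apply: (mxtrace_tens_id_prod _ (M := fun j => e (alpha j)) iS).
have d2_gt0 : (0 < d ^ 2)%N by rewrite expn_gt0 d_gt0.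
(* Orthogonality to the identity, at index 0, makes [e (alpha i)] traceless, since [ei] excludes
   [alpha i = 0]. *)
have := e_orth (Ordinal d2_gt0) (alpha i).
rewrite [e (Ordinal _)]e0 // trmx1 map_scalar_mx rmorph1 mul1mx => ->.
case: eqP => [alpha0|_]; last by rewrite mulr0.
by rewrite e0 ?eqxx // -alpha0 in ei.
Qed.

Lemma supp_tens_id S (B : oper C d (sites S)) : supp e (tens_id B) \subset S.
Proof.
apply/bigcupsP => alpha; apply: contraR => /subsetPn[j]; rewrite inE => ej jS.
have /eqP := op_coefE (tens_id B) alpha.
rewrite hsdotC tens_id_adj (mxtrace_tens_id_basis _ jS ej) conjC0 mulf_eq0.
by rewrite pnatr_eq0 expn_eq0 eqn0Ngt d_gt0.
Qed.

(** * From the code condition to masking *)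

Lemma hsnorm_reducedB eps K delta
    (V : {vspace ket C d 'I_n}) (psi1 psi2 : ket C d 'I_n) S :
  0 <= eps -> approx_qecc e eps K delta V ->
  psi1 \in V -> psi2 \in V -> is_state psi1 -> is_state psi2 ->
  (#|S| < delta)%N ->
  hsnorm (reduced S psi1 - reduced S psi2) <= 2 * eps :> C.
Proof.
move=> eps0 [_ [P _ qecc]] V1 V2 st1 st2 S_delta.
set D := reduced S psi1 - _.
(* The case [D = 0] is settled first, as the test operator divides by the norm of [D]. *)
have := hsnorm_ge0 D; rewrite le_eqVlt => /predU1P[<-|D_gt0].
  by rewrite mulr_ge0.
have dS_gt0 m : 0 < sqrtC (d ^ m)%:R :> C by rewrite sqrtC_gt0 ltr0n expn_gt0 d_gt0.
pose E := tens_id ((sqrtC (dS C d S) / hsnorm D) *: D ^t*).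
have E_norm : hsnorm E = sqrtC (d ^ n)%:R.
  rewrite hsnorm_tens_id hsnormZ ?divr_ge0 ?(ltW D_gt0) ?(ltW (dS_gt0 _)) //.
  rewrite hsnorm_adj divfK ?gt_eqF // -sqrtCM ?qualifE /= ?ler0n //.
  by rewrite -natrM -expnD addnC cardsC card_ord.
have suppE : supp e E \subset S by exact: supp_tens_id.
have wtE : (wt e E < delta)%N by apply: leq_ltn_trans S_delta; exact: subset_leq_card.
(* The code bounds the deviation by the dimension on [supp e E], which is at most that on [S]. *)
have near psi : psi \in V -> is_state psi ->
    `|expect psi E - \tr (E *m (K%:R^-1 *: P))| <= eps * sqrtC (dS C d S).
  move=> psiV psi_st; apply: le_trans (qecc _ _ psiV psi_st wtE E_norm) _.
  rewrite ler_wpM2l // ler_sqrtC ?qualifE /= ?ler0n //.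
  by rewrite ler_nat leq_pexp2l // subset_leq_card.
(* By duality the difference is a multiple of the trace of [D ^t* *m D], the squared norm of [D]. *)
have E_diff : expect psi1 E - expect psi2 E = sqrtC (dS C d S) * hsnorm D.
  rewrite !expectE -linearB /= -mulmxBr mxtrace_tens_id_ptrace ptraceB -/D.
  rewrite -scalemxAl linearZ /= -[\tr _]sqrtCK -/(hsnorm D) expr2 mulrA.
  by rewrite divfK ?gt_eqF.
rewrite -(ler_pM2l (dS_gt0 #|S|)) -E_diff.
have E_real : 0 <= expect psi1 E - expect psi2 E.
  by rewrite E_diff mulr_ge0 ?ltW //; apply: dS_gt0.
rewrite -(ger0_norm E_real).
apply: le_trans (ler_distD (\tr (E *m (K%:R^-1 *: P))) _ _) _.
rewrite [X in _ + X]distrC mulrC -mulrA mulrDl mul1r.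
by rewrite lerD ?near.
Qed.

Lemma approx_qecc_masks eps K delta
    (V : {vspace ket C d 'I_n}) :
  0 <= eps -> (0 < delta)%N ->
  approx_qecc e eps K delta V ->
  exists f : {linear 'cV[C]_K -> ket C d 'I_n},
    approx_masks (2 * eps) (delta - 1) (@is_state C K) f.
Proof.
move=> eps_ge0 delta_gt0 qecc; have dimV := qecc.1; subst K.
have [B B_unitary BV] := exists_orthonormal_basis V.
have B_isom (phi : 'cV_(\dim V)) : hsnorm (B^T *m phi) = hsnorm phi.
  exact: hsnorm_mulmx_trunitary.
exists (mulmx B^T); split=> // phi1 phi2 st1 st2 S cardS.
apply: (hsnorm_reducedB eps_ge0 qecc);
  rewrite ?BV /is_state ?B_isom //.
(* Subtraction on [nat] truncates, so [delta - 1 < delta] relies on [0 < delta]. *)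
by rewrite cardS subn1 prednK.
Qed.

End Basis.

Local Open Scope complex_scope.

Theorem theorem10 (R : realType) (eps : R) (d n K delta : nat)
    (e : 'I_(d ^ 2) -> 'M[R[i]]_d) :
  0 <= eps -> (0 < d)%N -> (0 < delta)%N ->
  op_basis e ->
  (exists V : {vspace ket R[i] d 'I_n},
      pure_approx_qecc e eps%:C K delta V) ->
  exists f : {linear 'cV[R[i]]_K -> ket R[i] d 'I_n},
    approx_masks (2 * eps)%:C (delta - 1) (@is_state R[i] K) f.
Proof.
move=> eps_ge0 d_gt0 delta_gt0 e_basis [V [V_qecc _]].
rewrite rmorphM rmorph_nat.
by apply: approx_qecc_masks V_qecc; rewrite ?ler0c.
Qed.
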